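(* Let $\Delta$ be a simplicial complex, $G$ a $\Delta$-graph, and $X$ a kingmaker set of $G$. Then \[ f^{\mathcal{N}(G,\Delta)}(s)=f^{\mathcal{N}(G\backslash X,\Delta\backslash X)}(s)+s\sum_{t\in \mathrm{intset}_X} f^{\mathcal{N}(G|_t)}(s)\, f^{\mathcal{N}((G/t)\backslash xn(t),\,(\Delta/t)\backslash xn(t))}(s). \]
   Context: A simplicial complex $\Delta$ on a finite base set $\mathcal{S}$ is a family of subsets of $\mathcal{S}$ closed under subsets and containing all singletons; its $f$-polynomial is $f^\Delta(s)=\sum_{k\ge0}f_ks^k$, where $f_k$ is the number of faces with $k$ elements. A $\Delta$-graph is a graph $G$ on $\mathcal{S}$ all of whose edges are faces of $\Delta$. A tube is a nonempty face of $\Delta$ inducing a connected subgraph of $G$. Two tubes $t_1,t_2$ are weakly compatible if $t_1\subset t_2$, or $t_2\subset t_1$, or $t_1\cap t_2=\emptyset$ and no edge joins $t_1$ to $t_2$. A set $T$ of tubes is strongly compatible (a tubing) if its tubes are pairwise weakly compatible and $\bigcup_{t\in T}t\in\Delta$; two tubes are compatible if together they form a tubing. $\mathcal{N}(G,\Delta)$ denotes the simplicial complex of all tubings. For $S\subseteq\mathcal{S}$, $G\backslash S$ is the graph induced on the vertices not in $S$, and $\Delta\backslash S$ is the complex of faces of $\Delta$ disjoint from $S$ (elements of $S$ not in the base set are ignored). For a tube $t$: the link is $\Delta/t=\{Y\in\Delta\mid Y\cup t\in\Delta,\ Y\cap t=\emptyset\}$; the reconnected complement $G/t$ is the $(\Delta/t)$-graph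 on the vertices $v\notin t$ with $t\cup\{v\}\in\Delta$, where $\{x,y\}\in\Delta/t$ is an edge if $\{x,y\}$ is an edge of $G$ or $x,y$ are both adjacent in $G$ to vertices of $t$; $G|_t$ is the subgraph induced on $t$, and $\mathcal{N}(G|_t)$ is its simplex-graph tubing complex, i.e. $\mathcal{N}(G|_t,\partial_t)$ where $\partial_t$ is the complex of proper subsets of $t$ (so tubes are the nonempty proper subsets of $t$ inducing connected subgraphs; when $|t|=1$ the complex is $\{\emptyset\}$); $xn(t)$ is the set of vertices not in $t$ that are adjacent in $G$ to a vertex of $t$. For a set $X$ of vertices, $\mathrm{intset}_X$ is the set of tubes of $G$ having nonempty intersection with $X$. $X$ is a kingmaker set if for any two compatible tubes $t_1,t_2\in \mathrm{intset}_X$, $t_1\subset t_2$ or $t_2\subset t_1$. *)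

(* Defs.v *)
From mathcomp Require Import all_boot all_order all_algebra.

Set Implicit Arguments.
Unset Strict Implicit.
Unset Printing Implicit Defensive.

Import GRing.Theory.
Local Open Scope ring_scope.

(* Complexes and graphs live on subsets of an ambient finite type [V], so that
   deletions, links and reconnected complements stay over the same type. *)
Record complex (V : finType) := Complex {
  base : {set V};
  faces : {set {set V}}
}.

Record graph (V : finType) := Graph {
  verts : {set V};
  adj : rel V
}.

Definition is_complex (V : finType) (D : complex V) : Prop :=
  [/\ forall F, F \in faces D -> F \subset base D,
      forall F H : {set V}, F \in faces D -> H \subset F -> H \in faces D
    & forall x, x \in base D -> [set x] \in faces D].

Definition is_graph (V : finType) (G : graph V) : Prop :=
  [/\ forall x y, adj G x y -> (x \in verts G) && (y \in verts G),
      irreflexive (adj G)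
    & symmetric (adj G)].

Definition is_complex_graph (V : finType) (D : complex V) (G : graph V) :
    Prop :=
  [/\ is_graph G,
      verts G = base D
    & forall x y, adj G x y -> [set x; y] \in faces D].

(* A face of a complex on [V] has at most [#|V|] elements. *)
Definition fpoly (V : finType) (D : complex V) : {poly int} :=
  \poly_(k < #|V|.+1) (#|[set F in faces D | #|F| == k]|)%:R.

Definition induced (V : finType) (G : graph V) (A : {set V}) : graph V :=
  Graph (verts G :&: A) [rel x y | [&& x \in A, y \in A & adj G x y]].

Definition connected_in (V : finType) (G : graph V) (A : {set V}) : bool :=
  [forall x in A, forall y in A, connect (adj (induced G A)) x y].

Definition tube (V : finType) (G : graph V) (D : complex V) (t : {set V}) :
    bool :=
  [&& t \in faces D, t != set0 & connected_in G t].

Definition weakly_compatible (V : finType) (G : graph V) (t1 t2 : {set V}) :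
    bool :=
  [|| t1 \subset t2, t2 \subset t1
    | [disjoint t1 & t2] && [forall x in t1, forall y in t2, ~~ adj G x y]].

Definition tubing (V : finType) (G : graph V) (D : complex V)
    (T : {set {set V}}) : bool :=
  [&& [forall t in T, tube G D t],
      [forall t1 in T, forall t2 in T, weakly_compatible G t1 t2]
    & cover T \in faces D].

Definition compatible (V : finType) (G : graph V) (D : complex V)
    (t1 t2 : {set V}) : bool :=
  tubing G D [set t1; t2].

Definition tubing_complex (V : finType) (G : graph V) (D : complex V) :
    complex {set V} :=
  Complex [set t | tube G D t] [set T | tubing G D T].

Definition graph_del (V : finType) (G : graph V) (S : {set V}) : graph V :=
  induced G (~: S).

Definition complex_del (V : finType) (D : complex V) (S : {set V}) :
    complex V :=
  Complex (base D :\: S) [set F in faces D | [disjoint F & S]].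

Definition link_base (V : finType) (D : complex V) (t : {set V}) : {set V} :=
  [set v in base D | (v \notin t) && (v |: t \in faces D)].

Definition link (V : finType) (D : complex V) (t : {set V}) : complex V :=
  Complex (link_base D t)
    [set Y in faces D | (Y :|: t \in faces D) && [disjoint Y & t]].

Definition adj_to (V : finType) (G : graph V) (t : {set V}) (x : V) : bool :=
  [exists u in t, adj G x u].

Definition reconnected_complement (V : finType) (G : graph V) (D : complex V)
    (t : {set V}) : graph V :=
  Graph (link_base D t)
    [rel x y | [&& x != y, [set x; y] \in faces (link D t)
                 & adj G x y || adj_to G t x && adj_to G t y]].

(* For a singleton [t] the only face is [set0], so this is then not an
   [is_complex]: the vertex of [t] is not a face. *)
Definition simplex_boundary (V : finType) (t : {set V}) : complex V :=
  Complex t [set F : {set V} | F \proper t].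

Definition simplex_tubing_complex (V : finType) (G : graph V) (t : {set V}) :
    complex {set V} :=
  tubing_complex (induced G t) (simplex_boundary t).

Definition xn (V : finType) (G : graph V) (t : {set V}) : {set V} :=
  [set v in verts G | (v \notin t) && adj_to G t v].

Definition intset (V : finType) (G : graph V) (D : complex V) (X : {set V}) :
    {set {set V}} :=
  [set t | tube G D t & t :&: X != set0].

Definition kingmaker (V : finType) (G : graph V) (D : complex V)
    (X : {set V}) : Prop :=
  X \subset verts G /\
  forall t1 t2 : {set V}, t1 \in intset G D X -> t2 \in intset G D X ->
    compatible G D t1 t2 -> t1 \subset t2 \/ t2 \subset t1.

(* Main.v *)
Require Import Defs.
From mathcomp Require Import all_boot all_order all_algebra.

Set Implicit Arguments.
Unset Strict Implicit.
Unset Printing Implicit Defensive.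

Import GRing.Theory.
Local Open Scope ring_scope.

(* The tubes of a tubing that meet a kingmaker set X form a chain.  If the chain
   is empty, the tubing lives on the complement of X.  Otherwise let t be its
   largest tube: the other tubes are either proper subsets of t, and form a
   tubing of G|_t, or are disjoint from and not adjacent to t, and form a tubing
   of (G/t) \ xn(t).  Conversely t and two such tubings always assemble to a
   tubing with top tube t, since a tube disjoint from t and compatible with it
   cannot meet X. *)

(** * The [f]-polynomial and restriction of tubings *)

Lemma fpolyE (V : finType) (D : complex V) :
  fpoly D = \sum_(F in faces D) 'X^#|F|.
Proof.
rewrite /fpoly poly_def.
(* The faces are grouped by size. A subset of [V] has at most [#|V|] elements, so [inord] never
   falls back to its default value here. *)
rewrite (partition_big (fun F : {set V} => inord #|F| : 'I_#|V|.+1) predT) //=.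
have cardK (F : {set V}) : (inord #|F| : 'I_#|V|.+1) = #|F| :> nat.
  by rewrite inordK // ltnS max_card.
apply: eq_bigr => k _.
rewrite (eq_bigr (fun=> 'X^k)) => [|F /andP[_ /eqP <-]]; last by rewrite cardK.
rewrite sumr_const scaler_nat; congr (_ *+ _).
by apply: eq_card => F; rewrite inE -[RHS]/(_ && _) -val_eqE /= cardK.
Qed.

Lemma connected_in_eq (V : finType) (G H : graph V) (t : {set V}) :
  {in t &, adj G =2 adj H} -> connected_in G t = connected_in H t.
Proof.
move=> eqGH; apply: eq_forallb_in => x _; apply: eq_forallb_in => y _.
apply: eq_connect => u v /=.
by case: (boolP (u \in t)) => //= ut; case: (boolP (v \in t)) => //= vt; apply: eqGH.
Qed.

Lemma weakly_compatible_eq (V : finType) (G H : graph V) (t1 t2 : {set V}) :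
    {in t1 & t2, adj G =2 adj H} ->
  weakly_compatible G t1 t2 = weakly_compatible H t1 t2.
Proof.
move=> eqGH; rewrite /weakly_compatible; do 2 congr (_ || _); congr (_ && _).
by apply: eq_forallb_in => x xt1; apply: eq_forallb_in => y yt2; rewrite eqGH.
Qed.

Lemma weakly_compatibleC (V : finType) (G : graph V) (t1 t2 : {set V}) :
  symmetric (adj G) -> weakly_compatible G t1 t2 = weakly_compatible G t2 t1.
Proof.
move=> symG; rewrite /weakly_compatible orbCA disjoint_sym.
do 2 congr (_ || _); congr (_ && _).
by apply/forall_inP/forall_inP => H x xt; apply/forall_inP => y yt;
  rewrite symG; have /forall_inP := H _ yt; apply.
Qed.

Lemma tubingP (V : finType) (G : graph V) (D : complex V) (T : {set {set V}}) :
  reflect [/\ {in T, forall t, tube G D t},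
              {in T &, forall t1 t2, weakly_compatible G t1 t2}
            & cover T \in faces D]
          (tubing G D T).
Proof.
apply: (iffP and3P) => [[/forall_inP tT /forall_inP wT cT]|[tT wT cT]]; split=> //.
- by move=> t1 t2 T1 T2; have /forall_inP := wT _ T1; apply.
- exact/forall_inP.
- by apply/forall_inP=> t1 T1; apply/forall_inP=> t2 T2; apply: wT.
Qed.

(** Isolated from [is_complex] because the boundary of a one-vertex simplex fails the latter, while
    the comparisons of tubings below must cover that case too. *)
Definition down_closed (V : finType) (D : complex V) : Prop :=
  forall F H : {set V}, F \in faces D -> H \subset F -> H \in faces D.

Lemma subset_cover (V : finType) (T : {set {set V}}) (t : {set V}) :
  t \in T -> t \subset cover T.
Proof. exact: bigcup_sup. Qed.

Lemma coverS (V : finType) (S T : {set {set V}}) :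
  S \subset T -> cover S \subset cover T.
Proof.
by move=> /subsetP ST; apply/bigcupsP => t /ST; apply: subset_cover.
Qed.

(** Being a tubing only involves adjacency between vertices of [cover T], and in a down-closed
    complex the one face [cover T] forces every tube of [T] to be a face. The three comparisons of
    tubings below all go through this lemma. *)
Lemma tubing_transfer (V : finType) (G H : graph V) (D E : complex V)
    (T : {set {set V}}) :
    {in cover T &, adj G =2 adj H} -> down_closed E -> cover T \in faces E ->
  tubing G D T -> tubing H E T.
Proof.
move=> eqGH dE cE /tubingP[tT wT _]; apply/tubingP; split=> //.
- move=> t Tt; have /and3P[_ t0 tc] := tT _ Tt; have /subsetP st := subset_cover Tt.
  rewrite /tube t0 (dE _ _ cE (subset_cover Tt)) -(@connected_in_eq _ G) //.
  by move=> x y /st xT /st; apply: eqGH.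
- move=> t1 t2 T1 T2; rewrite -(@weakly_compatible_eq _ G) ?wT //.
  have /subsetP s1 := subset_cover T1; have /subsetP s2 := subset_cover T2.
  by move=> x y /s1 xT /s2; apply: eqGH.
Qed.

Lemma tubingS (V : finType) (G : graph V) (D : complex V)
    (S T : {set {set V}}) :
  down_closed D -> S \subset T -> tubing G D T -> tubing G D S.
Proof.
move=> dD ST /tubingP[tT wT cT]; have /subsetP sST := ST.
apply/tubingP; split=> [t /sST|t1 t2 /sST T1 /sST|]; [exact: tT|exact: wT|].
exact: dD cT (coverS ST).
Qed.

Lemma disjoint_cover (V : finType) (T : {set {set V}}) (X : {set V}) :
  [disjoint cover T & X] = [forall t in T, t :&: X == set0].
Proof.
rewrite -setI_eq0; apply/eqP/forall_inP => [T0 t Tt|T0].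
  by rewrite -subset0 -T0 setSI ?subset_cover.
apply/setP => x; rewrite !inE; apply/negP => /andP[/bigcupP[t Tt xt] xX].
by have := T0 _ Tt; move/eqP/setP/(_ x); rewrite !inE xt xX.
Qed.

(** * Tubings of deletions, of [G|_t] and of reconnected complements *)

Lemma down_closed_del (V : finType) (D : complex V) (X : {set V}) :
  down_closed D -> down_closed (complex_del D X).
Proof.
move=> dD F H; rewrite !inE => /andP[FD FX] HF.
by rewrite (dD _ _ FD HF) (disjointWl HF FX).
Qed.

Lemma down_closed_link (V : finType) (D : complex V) (t : {set V}) :
  down_closed D -> down_closed (link D t).
Proof.
move=> dD F H; rewrite !inE => /and3P[FD FtD Ft] HF.
by rewrite (dD _ _ FD HF) (dD _ _ FtD (setSU t HF)) (disjointWl HF Ft).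
Qed.

Lemma down_closed_boundary (V : finType) (t : {set V}) :
  down_closed (simplex_boundary t).
Proof. by move=> F H; rewrite !inE => Ft HF; apply: sub_proper_trans Ft. Qed.

Lemma induced_adj (V : finType) (G : graph V) (A B : {set V}) :
  B \subset A -> {in B &, adj (induced G A) =2 adj G}.
Proof. by move=> /subsetP BA x y /BA xA /BA yA /=; rewrite xA yA. Qed.

(** A union avoids [X] exactly when each of its members does, and deleting [X] changes no adjacency
    off [X]. *)
Lemma tubing_delE (V : finType) (G : graph V) (D : complex V) (X : {set V})
    (T : {set {set V}}) :
    down_closed D ->
  tubing (graph_del G X) (complex_del D X) T =
    tubing G D T && [forall t in T, t :&: X == set0].
Proof.
move=> dD; rewrite -disjoint_cover; apply/idP/andP => [TX|[TG TX]].
  have /tubingP[_ _] := TX; rewrite inE => /andP[cD cX]; split=> //.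
  by apply: tubing_transfer TX => //; apply: induced_adj; rewrite -disjoints_subset.
have /tubingP[_ _ cD] := TG.
apply: tubing_transfer TG; last by rewrite inE cD.
  by move=> x y xT yT; rewrite (@induced_adj _ _ _ (cover T)) // -disjoints_subset.
exact: down_closed_del.
Qed.

(* A largest member of a weakly compatible family covering t would be closed
   under adjacency inside t. *)
Lemma cover_neq_connected (V : finType) (G : graph V) (t : {set V})
    (A : {set {set V}}) :
    t != set0 -> connected_in G t ->
    {in A &, forall t1 t2, weakly_compatible G t1 t2} ->
    {in A, forall u : {set V}, u \proper t /\ u != set0} -> cover A != t.
Proof.
move=> /set0Pn[x0 x0t] ct wA pA; apply/eqP => cA.
have [a0 Aa0 _] : exists2 a, a \in A & x0 \in a.
  by apply/bigcupP; rewrite -/(cover A) cA.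
case: (@arg_maxnP _ a0 [in A] (fun u : {set V} => #|u|) Aa0) => m Am maxm.
have [mt /set0Pn[x xm]] := pA _ Am.
have xt : x \in t by apply: (subsetP (proper_sub mt)).
have step u v : adj (induced G t) u v -> u \in m -> v \in m.
  move=> /= /and3P[ut vt uv] um.
  have /bigcupP[a Aa va] : v \in \bigcup_(B in A) B by rewrite -/(cover A) cA.
  have /or3P[ma|am|/andP[_ /forall_inP/(_ _ um)/forall_inP/(_ _ va)]] :=
    wA _ _ Am Aa.
  - by have /eqP -> : m == a by rewrite eqEcard ma; apply: maxm.
  - exact: (subsetP am).
  - by rewrite uv.
have tm : t \subset m.
  apply/subsetP => y yt.
  have /forall_inP/(_ _ xt)/forall_inP/(_ _ yt)/connectP[p + ->] := ct.
  elim: p x xm {xt} => [//|z p IHp] x xm /= /andP[xz].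
  exact/IHp/(step x).
by move: mt; rewrite properE tm andbF.
Qed.

(** The delicate direction is the converse: the cover of [A] must be a proper subset of [t],
    although a priori proper subsets of [t] could exhaust it. Connectedness of [t] excludes this
    through [cover_neq_connected]. *)
Lemma tubing_boundaryE (V : finType) (G : graph V) (D : complex V)
    (t : {set V}) (A : {set {set V}}) :
    down_closed D -> tube G D t ->
  tubing (induced G t) (simplex_boundary t) A =
    tubing G D A && [forall u in A, u \proper t].
Proof.
move=> dD /and3P[tD t0 ct]; apply/idP/andP => [At|[AG /forall_inP At]].
  have /tubingP[_ _] := At; rewrite inE => cAt; split.
    apply: tubing_transfer At => //; first exact/induced_adj/proper_sub.
    exact: dD tD (proper_sub cAt).
  by apply/forall_inP => u Au; apply: sub_proper_trans cAt; apply: subset_cover.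
have /tubingP[tA wA _] := AG.
have sAt : cover A \subset t by apply/bigcupsP => u /At/proper_sub.
apply: tubing_transfer AG; last 1 first.
- rewrite inE properEneq sAt andbT; apply: (@cover_neq_connected _ G) => //.
  by move=> u Au; have /and3P[_ u0 _] := tA _ Au; split; first exact: At.
- by move=> x y xA yA; rewrite (induced_adj G sAt).
- exact: down_closed_boundary.
Qed.

Lemma tube_neq0 (V : finType) (G : graph V) (D : complex V) (t : {set V}) :
  tube G D t -> t != set0.
Proof. by case/and3P. Qed.

Lemma disjointF (V : finType) (t u : {set V}) :
  t != set0 -> [disjoint t & u] -> t \subset u = false.
Proof.
move=> /set0Pn[x xt] tu; apply/negP => /subsetP/(_ _ xt).
by rewrite (disjointFr tu xt).
Qed.

Lemma disjoint_nonadjacent (V : finType) (G : graph V) (t u : {set V}) :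
    t != set0 -> u != set0 -> [disjoint t & u] -> weakly_compatible G t u ->
  {in t & u, forall x y, adj G x y = false}.
Proof.
move=> t0 u0 tu; have ut := tu; rewrite disjoint_sym in ut.
rewrite /weakly_compatible !disjointF //= tu /= => /forall_inP na x y xt yu.
by have /forall_inP/(_ _ yu)/negbTE := na _ xt.
Qed.

Lemma nonadjacent_weakly_compatible (V : finType) (G : graph V)
    (t u : {set V}) :
    [disjoint t & u] -> {in t & u, forall x y, adj G x y = false} ->
  weakly_compatible G t u.
Proof.
move=> tu na; rewrite /weakly_compatible tu /=; apply/or3P; constructor 3.
by apply/forall_inP => x xt; apply/forall_inP => y yu; rewrite na.
Qed.

Lemma weakly_compatible_refl (V : finType) (G : graph V) (t : {set V}) :
  weakly_compatible G t t.
Proof. by rewrite /weakly_compatible subxx. Qed.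

Lemma cover_setU1 (V : finType) (T : {set {set V}}) (t : {set V}) :
  cover (t |: T) = t :|: cover T.
Proof. by rewrite /cover bigcup_setU big_set1. Qed.

(** A face of the link that avoids [xn G t] contains no neighbour of [t], so none of the edges added
    by reconnection lies inside it. Pairs of its vertices are faces of the link by down-closure. *)
Lemma reconnected_adj (V : finType) (G : graph V) (D : complex V)
    (t B : {set V}) :
    is_graph G -> down_closed D ->
    B \in faces (complex_del (link D t) (xn G t)) ->
  {in B &, adj (graph_del (reconnected_complement G D t) (xn G t)) =2 adj G}.
Proof.
move=> [vG iG _] dD /[!inE] /andP[Blink Bxn] x y xB yB.
have Bl : B \in faces (link D t) by rewrite inE.
have xyl : [set x; y] \in faces (link D t).
  by apply: down_closed_link Bl _; rewrite // subUset !sub1set xB.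
have /and3P[_ _ Bt] := Blink.
have nadj z : z \in B -> adj_to G t z = false.
  move=> zB; case zt: (adj_to G t z) => //; have /exists_inP[u _ zu] := zt.
  have /andP[zG _] := vG _ _ zu; have := disjointFr Bxn zB.
  by rewrite inE zG (disjointFr Bt zB) zt.
rewrite /= !in_setC !(disjointFr Bxn) //= xyl (nadj x) //= orbF.
(* On the diagonal the reconnected complement has no loop by definition, and [G] has none by
   irreflexivity. *)
by case: eqVneq => //= ->; rewrite iG.
Qed.

(** For a tube disjoint from [t], avoiding [xn G t] amounts to weak compatibility with [t].
    Adjoining [t] to [B] on the right also encodes the link condition, since the cover of [t |: B]
    is the union of [t] and [cover B]. *)
Lemma tubing_reconnectedE (V : finType) (G : graph V) (D : complex V)
    (t : {set V}) (B : {set {set V}}) :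
    is_graph G -> down_closed D -> tube G D t ->
  tubing (graph_del (reconnected_complement G D t) (xn G t))
         (complex_del (link D t) (xn G t)) B =
    tubing G D (t |: B) && [forall u in B, [disjoint t & u]].
Proof.
move=> hG dD tt; have [vG iG sG] := hG; have t0 := tube_neq0 tt.
apply/idP/andP => [BR|[tB /forall_inP Bt]].
  have /tubingP[_ _ cB] := BR.
  have := cB; rewrite !inE => /andP[/and3P[cBD cBtD cBt] cBxn].
  have /tubingP[tB wB _] : tubing G D B.
    by apply: tubing_transfer BR => //; apply: reconnected_adj.
  have Bt u : u \in B -> [disjoint t & u].
    by move=> uB; rewrite disjoint_sym (disjointWl (subset_cover uB)).
  have tBw u : u \in B -> weakly_compatible G t u.
    move=> uB; apply: nonadjacent_weakly_compatible (Bt _ uB) _ => x y xt yu.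
    apply/negP => xy; have /andP[_ yG] := vG _ _ xy.
    have yB : y \in cover B by apply: (subsetP (subset_cover uB)).
    have yt : adj_to G t y by apply/exists_inP; exists x; rewrite // sG.
    by have := disjointFr cBxn yB; rewrite inE yG (disjointFr cBt yB) yt.
  split; last exact/forall_inP.
  apply/tubingP; split; last by rewrite cover_setU1 setUC.
    by move=> u /setU1P[->|/tB].
  move=> u v /setU1P[->|uB] /setU1P[->|vB].
  - exact: weakly_compatible_refl.
  - exact: tBw.
  - by rewrite weakly_compatibleC ?tBw.
  - exact: wB.
have /tubingP[tuT wT] := tB; rewrite cover_setU1 => cD.
have cB : cover B \in faces (complex_del (link D t) (xn G t)).
  rewrite !inE setUC cD (dD _ _ cD) ?subsetUr //=.
  have -> /= : [disjoint cover B & t].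
    by rewrite disjoint_cover; apply/forall_inP => u /Bt; rewrite setI_eq0 disjoint_sym.
  rewrite disjoint_cover; apply/forall_inP => u uB; rewrite setI_eq0.
  rewrite disjoint_subset; apply/subsetP => x xu; rewrite !inE.
  apply/negP => /and3P[_ _ /exists_inP[y yt]].
  have uT : u \in t |: B by rewrite !inE uB orbT.
  by rewrite sG (@disjoint_nonadjacent _ _ t u) ?Bt ?wT ?setU11 ?(tube_neq0 (tuT _ uT)).
apply: tubing_transfer (tubingS dD (subsetUr _ _) tB) => //.
  by move=> x y xB yB; rewrite (reconnected_adj hG dD cB).
by do 2?[apply: down_closed_del|apply: down_closed_link].
Qed.

(** * Counting tubings by their largest tube meeting [X] *)

(** That [t] itself meets [X] is left to the range [intset G D X] of the sums in which this
    predicate appears. *)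
Definition top_tube (V : finType) (X : {set V}) (T : {set {set V}})
    (t : {set V}) : bool :=
  (t \in T) && [forall u in T, (u :&: X != set0) ==> (u \subset t)].

(** The tubings with top tube [t] are in bijection with the pairs consisting of a tubing of [G|_t]
    and a tubing of the reconnected complement without [xn G t]. Sizes add up, and the factor ['X]
    accounts for [t]. *)
Lemma sum_top_tube (V : finType) (D : complex V) (G : graph V)
    (X t : {set V}) :
    is_graph G -> down_closed D -> kingmaker G D X -> t \in intset G D X ->
  \sum_(T | tubing G D T && top_tube X T t) 'X^#|T| =
    'X * (fpoly (simplex_tubing_complex G t) *
          fpoly (tubing_complex
                   (graph_del (reconnected_complement G D t) (xn G t))
                   (complex_del (link D t) (xn G t)))) :> {poly int}.
Proof.
move=> hG dD [_ hX] tX; have := tX; rewrite inE => /andP[tt tX0].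
have t0 := tube_neq0 tt; have [_ _ sG] := hG.
rewrite !fpolyE big_distrlr pair_big mulr_sumr /=.
pose h (p : {set {set V}} * {set {set V}}) := t |: (p.1 :|: p.2).
pose h' (T : {set {set V}}) :=
  ([set u in T | u \proper t], [set u in T | [disjoint t & u]]).
rewrite (reindex_onto h h') => [|T /andP[TG /andP[tT /forall_inP topT]]]; last first.
  have /tubingP[_ wT _] := TG.
  apply/setP => u; rewrite !inE -andb_orr.
  have [->|ut] /= := eqVneq u t; first by rewrite tT.
  apply: andb_idr => uT; rewrite properEneq ut /=.
  (* If [u] contains [t], then [u] meets [X] because [t] does, hence [u] lies in [t] by the choice
     of [t] as top tube. *)
  have /or3P[tu|->//|/andP[-> _]] := wT _ _ tT uT; last by rewrite orbT.
  rewrite (implyP (topT _ uT)) //; apply: contraNneq tX0 => uX.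
  by rewrite -subset0 -uX setSI.
(* Nonempty sets cannot be both inside [t] and disjoint from [t], so the two parts can be read off
   from their union with [t]. *)
have h'K (A B : {set {set V}}) : {in A, forall u : {set V}, u \proper t /\ u != set0} ->
    {in B, forall u : {set V}, [disjoint t & u] /\ u != set0} ->
    t \notin A :|: B /\ [disjoint A & B] /\ h' (h (A, B)) = (A, B).
  move=> At Bt.
  have AnB u : u \in A -> [disjoint t & u] = false.
    move=> uA; have [/proper_sub ut u0] := At _ uA.
    apply/negP => tu; have := disjointF u0; rewrite disjoint_sym in tu.
    by move=> /(_ _ tu); rewrite ut.
  have BnA u : u \in B -> u \proper t = false.
    move=> /Bt[tu u0]; rewrite disjoint_sym in tu.
    by rewrite properE disjointF.
  have tt0 : [disjoint t & t] = false by apply/negP => /(disjointF t0); rewrite subxx.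
  split; [|split].
  - by rewrite inE; apply/negP => /orP[/At|/Bt]; rewrite ?properxx ?tt0 => -[].
  - rewrite disjoint_subset; apply/subsetP => u uA; rewrite !inE.
    by apply/negP => /Bt[]; rewrite AnB.
  - congr (_, _); apply/setP => u; rewrite !inE.
    + have [->|_] /= := eqVneq u t.
        by rewrite properxx; apply/esym/negP => /At[]; rewrite properxx.
      have [uA|_] /= := boolP (u \in A); first by have [-> _] := At _ uA.
      by have [/BnA|//] := boolP (u \in B).
    + have [->|_] /= := eqVneq u t.
        by rewrite tt0; apply/esym/negP => /Bt[]; rewrite tt0.
      have [uA|_] /= := boolP (u \in A).
        by rewrite AnB //; apply/esym/negP => /Bt[]; rewrite AnB.
      by have [uB|//] := boolP (u \in B); have [-> _] := Bt _ uB.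
(* The domain left by the reindexing is the product of the two families of tubings. *)
have hP p : (tubing G D (h p) && top_tube X (h p) t) && (h' (h p) == p) =
   (tubing (induced G t) (simplex_boundary t) p.1 &&
    tubing (graph_del (reconnected_complement G D t) (xn G t))
         (complex_del (link D t) (xn G t)) p.2).
  case: p => A B /=; rewrite (tubing_boundaryE _ dD) // tubing_reconnectedE //.
  apply/andP/andP => [[/andP[TG /andP[tT topT]] /eqP[eA eB]]|].
    set T := h _ in TG tT topT eA eB.
    split; apply/andP; split.
    - by apply: tubingS TG => //; rewrite -eA; apply/subsetP => u; rewrite inE => /andP[].
    - by apply/forall_inP => u; rewrite -eA inE => /andP[].
    - apply: tubingS TG => //; rewrite subUset sub1set tT -eB.
      by apply/subsetP => u; rewrite inE => /andP[].
    - by apply/forall_inP => u; rewrite -eB inE => /andP[].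
  move=> [/andP[AG /forall_inP At] /andP[tBG /forall_inP Bt]].
  have /tubingP[tA wA cA] := AG; have /tubingP[tB wB cB] := tBG.
  have At' : {in A, forall u : {set V}, u \proper t /\ u != set0}.
    by move=> u uA; split; [exact: At | exact: tube_neq0 (tA _ uA)].
  have inB u : u \in B -> u \in t |: B by rewrite !inE orbC => ->.
  have Bt' : {in B, forall u : {set V}, [disjoint t & u] /\ u != set0}.
    by move=> u uB; split; [exact: Bt | exact: tube_neq0 (tB _ (inB _ uB))].
  have [_ [_ ->]] := h'K _ _ At' Bt'; split=> //; apply/andP; split.
    have wtA u : u \in A -> weakly_compatible G t u.
      by move=> /At/proper_sub ut; rewrite /weakly_compatible ut orbT.
    (* Since [u] lies in [t], it inherits from [t] both disjointness from [v] and the absence of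
       edges to [v]. *)
    have wAB u v : u \in A -> v \in B -> weakly_compatible G u v.
      move=> uA vB; have [/proper_sub ut u0] := At' _ uA; have [tv v0] := Bt' _ vB.
      apply: nonadjacent_weakly_compatible; first exact: disjointWl tv.
      move=> x y xu yv; apply: (disjoint_nonadjacent t0 v0 tv _ _ yv).
        by apply: wB; rewrite ?setU11 ?inB.
      exact: (subsetP ut).
    apply/tubingP; split.
    - by move=> u /setU1P[->//|/setUP[/tA//|/inB/tB]].
    - move=> u v /setU1P[->|/setUP[uA|uB]] /setU1P[->|/setUP[vA|vB]].
      + exact: weakly_compatible_refl.
      + exact: wtA.
      + by apply: wB; rewrite ?setU11 ?inB.
      + by rewrite weakly_compatibleC ?wtA.
      + exact: wA.
      + exact: wAB.
      + by apply: wB; rewrite ?setU11 ?inB.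
      + by rewrite weakly_compatibleC ?wAB.
      + by apply: wB; rewrite inB.
    (* The tubes of [A] lie inside [t], so they add nothing to the cover of [t |: B], already known
       to be a face. *)
    - apply: dD cB _; apply/bigcupsP => u /setU1P[->|/setUP[/At/proper_sub ut|/inB]].
      + by rewrite subset_cover ?setU11.
      + by rewrite (subset_trans ut) ?subset_cover ?setU11.
      + exact: subset_cover.
  (* The kingmaker property enters here: a tube of [B] meeting [X] would be nested with [t], which
     contradicts disjointness. *)
  rewrite /top_tube setU11 /=; apply/forall_inP => u uT; apply/implyP => uX0.
  case/setU1P: uT => [->//|/setUP[/At/proper_sub//|uB]].
  have tuc : compatible G D t u.
    by apply: tubingS tBG; rewrite // subUset !sub1set setU11 inB.
  have uX : u \in intset G D X by rewrite inE uX0 (tB _ (inB _ uB)).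
  have [tu u0] := Bt' _ uB.
  by case: (hX _ _ tX uX tuc) => //; rewrite disjointF.
apply: eq_big => [p|[A B]]; first by rewrite hP !inE.
rewrite hP /= (tubing_boundaryE _ dD) // tubing_reconnectedE // => /andP[].
move=> /andP[/tubingP[tA _ _] /forall_inP At] /andP[/tubingP[tB _ _] /forall_inP Bt].
have [||tAB [dAB _]] := h'K A B.
- by move=> u uA; split; [exact: At | exact: tube_neq0 (tA _ uA)].
- move=> u uB; split; first exact: Bt.
  by apply: (@tube_neq0 _ G D); apply: tB; rewrite !inE uB orbT.
by rewrite /h cardsU1 tAB cardsU disjoint_setI0 // cards0 subn0 exprD exprD.
Qed.

(** Any two members of a tubing are compatible, so those meeting [X] are nested and one of largest
    cardinality contains the others. The conclusion is phrased so that a sum over top tubes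
    collapses by [big_pred1]. *)
Lemma top_tube_unique (V : finType) (D : complex V) (G : graph V)
    (X : {set V}) (T : {set {set V}}) :
    down_closed D -> kingmaker G D X -> tubing G D T ->
    ~~ [forall t in T, t :&: X == set0] ->
  exists t, [pred u in intset G D X | top_tube X T u] =1 pred1 t.
Proof.
move=> dD [_ hX] TG; have /tubingP[tT _ _] := TG.
rewrite negb_forall_in => /exists_inP[t1 t1T t1X].
pose P := [pred t | (t \in T) && (t :&: X != set0)].
have Pt1 : P t1 by rewrite /= t1T.
case: (@arg_maxnP _ t1 P (fun u : {set V} => #|u|) Pt1) => t /andP[tTt tX] maxt.
have tint u : u \in T -> u :&: X != set0 -> u \in intset G D X.
  by move=> uT uX; rewrite inE uX tT.
exists t => u /=; apply/andP/eqP => [[uint /andP[uT /forall_inP topu]]|->].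
  apply/esym/eqP; rewrite eqEcard (implyP (topu _ tTt)) //=.
  by apply: maxt; rewrite /= uT; move: uint; rewrite inE => /andP[].
split; first exact: tint.
rewrite /top_tube tTt; apply/forall_inP => v vT; apply/implyP => vX.
have tvc : compatible G D t v.
  by apply: tubingS TG; rewrite // subUset !sub1set tTt.
case: (hX _ _ (tint _ tTt tX) (tint _ vT vX) tvc) => // tv.
suff /eqP -> : t == v by [].
by rewrite eqEcard tv; apply: maxt; rewrite /= vT.
Qed.

Theorem proposition5p3p7 (V : finType) (D : complex V) (G : graph V)
    (X : {set V}) (hD : is_complex D) (hG : is_complex_graph D G)
    (hX : kingmaker G D X) :
  fpoly (tubing_complex G D) =
    fpoly (tubing_complex (graph_del G X) (complex_del D X)) +
    'X * \sum_(t in intset G D X)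
           fpoly (simplex_tubing_complex G t) *
           fpoly (tubing_complex
                    (graph_del (reconnected_complement G D t) (xn G t))
                    (complex_del (link D t) (xn G t))).
Proof.
have [_ dD _] := hD; have [gG _ _] := hG.
rewrite [LHS]fpolyE [X in _ = X + _]fpolyE.
(* Tubings avoiding [X] give the first summand, and the others are counted through their top
   tube. *)
rewrite (bigID (fun T : {set {set V}} => [forall t in T, t :&: X == set0])) /=.
congr (_ + _); first by apply: eq_bigl => T; rewrite !inE tubing_delE.
rewrite mulr_sumr.
under [RHS]eq_bigr => t tX do rewrite -(sum_top_tube gG dD hX tX).
(* After the exchange, each tubing with a tube meeting [X] is the outer index, and its inner sum
   runs over its top tubes, of which there is exactly one. *)
rewrite (exchange_big_dep (fun T : {set {set V}} =>
  (T \in [set T | tubing G D T]) && ~~ [forall t in T, t :&: X == set0])) /=.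
  apply: eq_bigr => T /[!inE] /andP[TG TX].
  have [t tE] := top_tube_unique dD hX TG TX.
  by rewrite (big_pred1 t) // => u; rewrite TG -tE.
move=> t T /[!inE] /andP[_ tX] /andP[-> /andP[tT _]].
by rewrite negb_forall_in; apply/exists_inP; exists t.
Qed.
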